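(* Let $m\le n$, let $U_1,U_2\in Sp_m(q)$ and $U=U_1U_2$, and let $d=\dim\ker(U-I)$ (kernel on the $2m$-dimensional space $V_m$). Assume that the Jordan form of $U$ has no identity block, i.e. no Jordan block of size $1$ with eigenvalue $1$. Then $$|C_{Sp_n(q)}(U^{\uparrow\uparrow n})|=|C_{Sp_m(q)}(U)|\cdot|Sp_{n-m}(q)|\cdot q^{2(n-m)d}.$$ If moreover $rl(U_1)+rl(U_2)=rl(U)$, then $$|C_{Sp_n(q)}(U_1^{\uparrow\uparrow n})\cap C_{Sp_n(q)}(U_2^{\uparrow\uparrow n})|=|C_{Sp_m(q)}(U_1)\cap C_{Sp_m(q)}(U_2)|\cdot|Sp_{n-m}(q)|\cdot q^{2(n-m)d}.$$
   Context: $q$ is an odd prime power. $V_n$ is the $2n$-dimensional $\mathbb F_q$-space with basis $e_1,f_1,\dots,e_n,f_n$ and alternating form $Q$ with $Q(e_i,f_j)=\delta_{ij}$, $Q(e_i,e_j)=Q(f_i,f_j)=0$; $Sp_n(q)\subset GL_{2n}(q)$ is its isometry group ($Sp_0(q)$ is trivial). For $U\in GL_{2m}(q)$ and $n\ge m$, $U^{\uparrow\uparrow n}=\begin{bmatrix}U&0\\0&I_{2n-2m}\end{bmatrix}\in GL_{2n}(q)$; this embeds $Sp_m(q)$ in $Sp_n(q)$. $C_G(g)$ is the centralizer of $g$ in $G$. A reflection is an element $T\in GL_{2m}(q)$ with $\dim (T-I)V_m=1$; the reflection length $rl(U)$ is the minimal $r$ such that $U$ is a product of $r$ reflections of $GL_{2m}(q)$.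 *)

(* Defs.v *)
From HB Require Import structures.
From mathcomp Require Import all_boot all_order all_algebra.

Set Implicit Arguments.
Unset Strict Implicit.
Unset Printing Implicit Defensive.

Import GRing.Theory.

Local Open Scope ring_scope.

(* Matrices act on column vectors. The ordered basis e_1, f_1, ..., e_n, f_n   *)
(* is indexed from 0: e_i has index 2(i-1) and f_i has index 2(i-1)+1.         *)
Definition gram (F : finFieldType) (n : nat) : 'M[F]_(2 * n) :=
  \matrix_(i, j) if ~~ odd i && (nat_of_ord j == i.+1) then 1
                 else if ~~ odd j && (nat_of_ord i == j.+1) then -1
                 else 0.

Definition Q (F : finFieldType) (n : nat) (v w : 'cV[F]_(2 * n)) : F :=
  (v^T *m gram F n *m w) 0 0.

(* Sets of plain matrices are used rather than {set {'GL_(2 * n)[F]}} because  *)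
(* {'GL_0[F]} is the group of 1 x 1 matrices, whereas Sp_0 must be trivial.    *)
Definition Sp (F : finFieldType) (n : nat) : {set 'M[F]_(2 * n)} :=
  [set A in unitmx |
    [forall v : 'cV[F]_(2 * n), forall w : 'cV[F]_(2 * n),
       Q (A *m v) (A *m w) == Q v w]].

Definition centSp (F : finFieldType) (n : nat) (B : 'M[F]_(2 * n)) :
    {set 'M[F]_(2 * n)} :=
  [set A in Sp F n | A *m B == B *m A].

Lemma upup_size (m n : nat) : (m <= n)%N -> (2 * m + (2 * n - 2 * m) = 2 * n)%N.
Proof. by move=> le_mn; rewrite subnKC // leq_mul2l le_mn. Qed.

Definition upup (F : finFieldType) (m n : nat) (le_mn : (m <= n)%N)
    (U : 'M[F]_(2 * m)) : 'M[F]_(2 * n) :=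
  castmx (upup_size le_mn, upup_size le_mn) (block_mx U 0 0 1%:M).

Definition dim_fix (F : fieldType) (k : nat) (U : 'M[F]_k) : nat :=
  \rank (cokermx (U - 1%:M)).

Definition jordan_block (L : fieldType) (a : L) (k : nat) : 'M[L]_k :=
  \matrix_(i, j) if i == j then a
                 else if nat_of_ord j == i.+1 then 1 else 0.

(* The base change matrices P, P' are a priori rectangular; being mutually     *)
(* inverse they force \sum_b sz b = k.                                         *)
Definition has_jordan_form (L : fieldType) (k : nat) (A : 'M[L]_k)
    (r : nat) (ev : 'I_r -> L) (sz : 'I_r -> nat) : Prop :=
  (forall b, 0 < sz b)%N /\
  exists (P : 'M[L]_(k, \sum_b sz b)) (P' : 'M[L]_(\sum_b sz b, k)),
    [/\ P *m P' = 1%:M, P' *m P = 1%:M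
      & A = P *m (\mxdiag_b jordan_block (ev b) (sz b)) *m P'].

(* A Jordan form exists over every extension L of F containing the eigenvalues *)
(* and, up to the order of the blocks, does not depend on L.                   *)
Definition no_identity_block (F : fieldType) (k : nat) (A : 'M[F]_k) : Prop :=
  exists (L : fieldType) (iota : {rmorphism F -> L})
         (r : nat) (ev : 'I_r -> L) (sz : 'I_r -> nat),
    has_jordan_form (map_mx iota A) ev sz /\
    forall b, ~ (ev b = 1 /\ sz b = 1%N).

Definition is_reflection (F : fieldType) (k : nat) (T : 'M[F]_k) : Prop :=
  T \in unitmx /\ \rank (T - 1%:M) = 1%N.

Definition reflection_product (F : fieldType) (k : nat) (U : 'M[F]_k) (r : nat)
    : Prop :=
  exists2 s : seq 'M[F]_k,
    size s = r /\ (forall T, T \in s -> is_reflection T)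
    & U = \big[mulmx/1%:M]_(T <- s) T.

(* rl U r states that the reflection length of U is r. *)
Definition rl (F : fieldType) (k : nat) (U : 'M[F]_k) (r : nat) : Prop :=
  reflection_product U r /\ forall r', reflection_product U r' -> (r <= r')%N.

(* Main.v *)
(* Put k = n - m and let U be U1 U2, with fixed space K. Without identity block, K
   is contained in the image of U - 1, which is orthogonal to K; so K is totally
   isotropic. A matrix [[a, b], [c, e]] commuting with diag(U, 1) has the
   columns of b in K, so e is symplectic. It then factors uniquely as
   shear(b e^-1) * diag(a', e), where the shears are explicit symplectic matrices
   commuting with diag(U, 1), parametrised by the 2k-tuples of vectors of K; this needs
   an inverse of 2. As a' is an arbitrary element of the centralizer of U, this
   gives the first count.

   The same argument counts the common centralizer of U1 and U2 once their common
   fixed space is K. The reflection length of g is the rank of g - 1: that it is at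
   most this rank follows by splitting off reflections with Wedderburn's rank
   reduction. If the lengths add up, then the row space of U2 - 1 is contained in
   that of U - 1, so that U2, and therefore U1, fixes K pointwise. *)
Require Import Defs.
From HB Require Import structures.
From mathcomp Require Import all_boot all_order all_algebra.

Set Implicit Arguments.
Unset Strict Implicit.
Unset Printing Implicit Defensive.

Import GRing.Theory.

Local Open Scope ring_scope.

(** * Isometry groups of a Gram matrix *)

Definition isom (F : finFieldType) (N : nat) (G : 'M[F]_N) : {set 'M[F]_N} :=
  [set A | A^T *m G *m A == G].

(** Translation by 1 permutes [F], so summing over [F] gives [#|F|] times 1 equal to 0; with 2 = 0
    and [#|F|] odd this would read 1 = 0. *)
Lemma two_neq0 (F : finFieldType) : odd #|F| -> 2%:R != 0 :> F.
Proof.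
move=> oddF; apply/negP=> /eqP two0; have /eqP := oner_neq0 F; apply.
have : \sum_(x : F) (x + 1) = \sum_(x : F) x.
  by rewrite [RHS](reindex_inj (addIr 1)).
rewrite big_split /= sumr_const -[RHS]addr0 => /addrI.
by rewrite -[#|F|]odd_double_half oddF -muln2 natrD natrM two0 mulr0 addr0.
Qed.

Lemma bilinP (F : fieldType) (N : nat) (A B : 'M[F]_N) :
  (forall v w : 'cV[F]_N, (v^T *m A *m w) 0 0 = (v^T *m B *m w) 0 0) -> A = B.
Proof.
have E (C : 'M[F]_N) i j :
    ((delta_mx i 0 : 'cV_N)^T *m C *m (delta_mx j 0 : 'cV_N)) 0 0 = C i j.
  by rewrite trmx_delta -rowE -colE !mxE.
by move=> h; apply/matrixP=> i j; rewrite -E h E.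
Qed.

Lemma gram_tr (F : finFieldType) (n : nat) : (gram F n)^T = - gram F n.
Proof.
apply/matrixP=> i j; rewrite !mxE.
have [ei|oi] := boolP (odd i); have [ej|oj] := boolP (odd j) => //=;
  rewrite ?oppr0 //; try by case: eqP; rewrite ?opprK ?oppr0.
case: (eqVneq (i : nat) j.+1) => [e|_]; first by rewrite e /= oj in oi.
case: (eqVneq (j : nat) i.+1) => [e|_]; first by rewrite e /= oi in oj.
by rewrite oppr0.
Qed.

Lemma gram_sqr (F : finFieldType) (n : nat) : gram F n *m gram F n = - 1%:M.
Proof.
apply/matrixP=> i j; rewrite !mxE.
(* Row i of [gram] has a single nonzero entry: -1 in column i-1 for odd i, and 1 in column i+1 for
   even i. *)
have [oi|ei] := boolP (odd i).
  have i_gt0 : (0 < i)%N by case: (nat_of_ord i) oi.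
  have lt_p : (i.-1 < 2 * n)%N by rewrite (leq_ltn_trans (leq_pred _)).
  have op : ~~ odd i.-1 by case: (nat_of_ord i) oi => //= k; rewrite negbK => /negPf ->.
  rewrite (bigD1 (Ordinal lt_p)) //= !mxE oi op /= prednK // eqxx big1 ?addr0.
    rewrite mulN1r -val_eqE /= [(i == j :> nat)]eq_sym.
    case: eqP => // ne; case: ifP => // /andP[oj /eqP ej].
    by move: op; rewrite ej /= oj.
  move=> k nk; rewrite !mxE oi /=; case: ifP => [/andP[ok /eqP ek]|]; rewrite ?mul0r //.
  by case/eqP: nk; apply: val_inj; rewrite /= ek.
have lt_s : (i.+1 < 2 * n)%N.
  rewrite ltn_neqAle ltn_ord andbT; apply/eqP=> e.
  by have := congr1 odd e; rewrite oddM /= ei.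
rewrite (bigD1 (Ordinal lt_s)) //= !mxE ei /= eqxx mul1r (negPf ei) /= big1 ?addr0.
  rewrite -val_eqE /= eqSS.
  case: (eqVneq (i : nat) j) => [<-|]; first by rewrite ei.
  by rewrite andbF mulr0n oppr0.
move=> k nk; rewrite !mxE ei /=.
have -> : (k == i.+1 :> nat) = false by apply: contraNF nk => /eqP e; apply/eqP/val_inj.
case: ifP; rewrite ?mul0r // => /andP[ok /eqP e].
by move: ei; rewrite e /= ok.
Qed.

Lemma unit_of_sqrN1 (F : fieldType) (N : nat) (G : 'M[F]_N) :
  G *m G = - 1%:M -> G \in unitmx.
Proof.
move=> GG; have /mulmx1_unit[] // : G *m (- G) = 1%:M.
by rewrite mulmxN GG opprK.
Qed.

Lemma isom_unit (F : finFieldType) (N : nat) (G A : 'M[F]_N) :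
  G \in unitmx -> A \in isom G -> A \in unitmx.
Proof.
move=> Gu; rewrite inE => /eqP h; have := Gu; rewrite -h.
by rewrite unitmx_mul => /andP[].
Qed.

Lemma Sp_isom (F : finFieldType) (n : nat) : Sp F n = isom (gram F n).
Proof.
apply/setP=> A; apply/idP/idP => [|hA].
  rewrite inE => /andP[_ /forallP h]; rewrite inE; apply/eqP/bilinP=> v w.
  have /forallP/(_ w)/eqP := h v; rewrite /Q => <-.
  by rewrite trmx_mul !mulmxA.
rewrite inE (isom_unit (unit_of_sqrN1 (gram_sqr F n)) hA) /=.
apply/forallP=> v; apply/forallP=> w; apply/eqP; rewrite /Q.
move: hA; rewrite inE => /eqP hA.
by rewrite trmx_mul -{2}hA !mulmxA.
Qed.

(** * Fixed vectors of a matrix *)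

(** The columns of [C] form a basis of the fixed space; the left inverse [L] makes the
    parametrisation by [y] injective. *)
Lemma fixed_mx_param (F : fieldType) (p : nat) (U : 'M[F]_p) :
  exists (C : 'M[F]_(p, dim_fix U)) (L : 'M[F]_(dim_fix U, p)),
    [/\ L *m C = 1%:M, U *m C = C &
        forall (r : nat) (b : 'M[F]_(p, r)), U *m b = b -> exists y, b = C *m y].
Proof.
set M := U - 1%:M; pose K := cokermx M; rewrite /dim_fix -/M -/K.
have [L LC] := row_fullP (col_base_full K).
have /row_freeP[R KR] := row_base_free K.
have CE : col_base K = K *m R.
  by have := congr1 (mulmx^~ R) (mulmx_base K); rewrite -mulmxA KR mulmx1.
exists (col_base K), L; split=> // [|r b Ub].
  apply/eqP; rewrite -subr_eq0 -{2}[col_base K]mul1mx -mulmxBl -/M CE.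
  by rewrite mulmxA mulmx_coker mul0mx.
exists (row_base K *m (row_ebase M *m b)).
rewrite mulmxA mulmx_base mulmxA /K /cokermx.
(* Since M b = 0, the first [\rank M] coordinates of [row_ebase M *m b] vanish, so [copid_mx] leaves
   it unchanged. *)
have h : pid_mx (\rank M) *m (row_ebase M *m b) = 0 :> 'M_(p, r).
  apply: (can_inj (mulKmx (col_ebase_unit M))).
  by rewrite !mulmxA mulmx_ebase mulmx0 mulmxBl mul1mx Ub subrr.
rewrite -!mulmxA /copid_mx mulmxBl mul1mx h subr0 mulKmx //.
exact: row_ebase_unit.
Qed.

Lemma card_fixed_mx (F : finFieldType) (p r : nat) (U : 'M[F]_p) :
  #|[set b : 'M[F]_(p, r) | U *m b == b]| = (#|F| ^ (r * dim_fix U))%N.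
Proof.
have [C [L [LC UC fixC]]] := fixed_mx_param U.
have -> : [set b : 'M[F]_(p, r) | U *m b == b] = [set C *m y | y : 'M_(dim_fix U, r)].
  apply/setP=> b; rewrite inE; apply/eqP/imsetP=> [/fixC[y ->] | [y _ ->]].
    by exists y.
  by rewrite mulmxA UC.
rewrite card_imset ?card_mx 1?mulnC // => y1 y2 /(congr1 (mulmx L)).
by rewrite !mulmxA LC !mul1mx.
Qed.

(** * Jordan blocks and isotropy of the fixed space *)

(* X M + M Y = 1 implies ker M <= im M, and unlike this inclusion it is visibly
   compatible with block sums and conjugation. *)
Lemma jordan_block_split (L : fieldType) (a : L) (k : nat) :
  ~ (a = 1 /\ k = 1%N) -> (0 < k)%N ->
  exists X Y : 'M[L]_k, let M := jordan_block a k - 1%:M in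
    X *m M + M *m Y = 1%:M.
Proof.
move=> no_id k_gt0; set M := jordan_block a k - 1%:M.
have [a1|an1] := eqVneq a 1; last first.
  (* For a different from 1, M is triangular with the nonzero diagonal entry a - 1. *)
  exists (invmx M), 0; rewrite /= -/M mulmx0 addr0 mulVmx //.
  rewrite unitmxE -det_tr det_trig; last first.
    apply/is_trig_mxP=> i j lt_ij; rewrite !mxE.
    have -> : (j == i) = false by apply/eqP=> e; rewrite e ltnn in lt_ij.
    by case: eqP lt_ij => [->|_ _]; rewrite ?subrr // ltnNge leqnSn.
  rewrite (eq_bigr (fun=> a - 1)) => [|i _]; last by rewrite !mxE eqxx.
  by rewrite prodr_const unitrX // unitfE subr_eq0.
case: k => [|[|k]] // in M no_id k_gt0 *; first by case: no_id.
have ME i j : M i j = (j == i.+1 :> nat)%:R.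
  rewrite !mxE a1; case: (eqVneq i j) => [->|_].
    by rewrite subrr; case: eqP => // e; have := ltnSn j; rewrite -[X in (_ < X)%N]e ltnn.
  by rewrite subr0; case: eqP.
(* M is the nilpotent shift of size k+2. M M^T lacks only the last diagonal entry of the identity,
   and row k of M, moved to the last row, supplies it. *)
exists (delta_mx ord_max (inord k)), M^T; rewrite /= -/M; apply/matrixP=> i j.
rewrite mxE [X in _ + X]mxE [X in X + _]mxE [RHS]mxE.
rewrite (bigD1 (inord k)) //= big1 ?addr0 => [|l nl]; last first.
  by rewrite mxE (negPf nl) andbF mul0r.
rewrite [delta_mx _ _ _ _]mxE eqxx andbT ME inordK // .
have [->|ni] := eqVneq i ord_max.
  rewrite big1 ?addr0 ?mul1r => [|l _].
    by rewrite -val_eqE /= eq_sym.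
  by rewrite ME /= (ltn_eqF (ltn_ord l)) mul0r.
rewrite mul0r add0r.
have lt_i : (i.+1 < k.+2)%N.
  have := ltn_ord i; rewrite leq_eqVlt => /orP[/eqP[e]|//].
  by case/eqP: ni; apply: val_inj.
rewrite (bigD1 (Ordinal lt_i)) //= big1 ?addr0 => [|l nl]; last first.
  rewrite ME (_ : (l == i.+1 :> nat) = false) ?mul0r //.
  by apply: contraNF nl => /eqP e; apply/eqP/val_inj.
by rewrite [M^T _ _]mxE !ME eqxx mul1r eqSS -val_eqE.
Qed.

Lemma mul_mxdiag (R : pzSemiRingType) (r : nat) (sz : 'I_r -> nat)
    (B C : forall b, 'M[R]_(sz b)) :
  (\mxdiag_b B b) *m (\mxdiag_b C b) = \mxdiag_b (B b *m C b).
Proof.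
rewrite {2}/mxdiag mul_mxdiag_mxblock; apply: eq_mxblock => i j.
by case: eqVneq => [e|_]; rewrite ?mulmx0 //; case: _ / e; rewrite !conform_mx_id.
Qed.

Lemma no_identity_block_split (F : fieldType) (k : nat) (A : 'M[F]_k) :
  no_identity_block A ->
  exists (L : fieldType) (iota : {rmorphism F -> L}) (X Y : 'M[L]_k),
    let M := map_mx iota A - 1%:M in X *m M + M *m Y = 1%:M.
Proof.
case=> L [iota [r [ev [sz [[sz_gt0 [P [P' [PP' P'P AE]]] no_id]]]]]].
exists L, iota.
have hb b : exists XY : 'M[L]_(sz b) * 'M[L]_(sz b),
  let M := jordan_block (ev b) (sz b) - 1%:M in XY.1 *m M + M *m XY.2 == 1%:M.
  have [X [Y h]] := jordan_block_split (no_id b) (sz_gt0 b).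
  by exists (X, Y); apply/eqP.
pose X b := (xchoose (hb b)).1; pose Y b := (xchoose (hb b)).2.
exists (P *m (\mxdiag_b X b) *m P'), (P *m (\mxdiag_b Y b) *m P').
set D := \mxdiag_b _ in AE.
have -> : map_mx iota A - 1%:M = P *m (\mxdiag_b (jordan_block (ev b) (sz b) - 1%:M)) *m P'.
  rewrite AE mxdiagB -/D.
  have -> : \mxdiag_b (1%:M : 'M[L]_(sz b)) = 1%:M.
    by rewrite mxdiagZ.
  by rewrite mulmxBr mulmxBl mulmx1 PP'.
have conjM (B C : 'M[L]_(\sum_b sz b)) :
    (P *m B *m P') *m (P *m C *m P') = P *m (B *m C) *m P'.
  by rewrite -!mulmxA (mulmxA P') P'P mul1mx.
rewrite /= !conjM -mulmxDl -mulmxDr !mul_mxdiag -mxdiagD.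
rewrite (_ : \mxdiag_b _ = 1%:M) ?mulmx1 //.
rewrite -(mxdiagZ 1); apply: eq_mxdiag => b.
exact/eqP/(xchooseP (hb b)).
Qed.

(* The fixed space of U is orthogonal to the image of U - 1, which contains it. *)
Lemma fixed_isotropic (F : fieldType) (p r s : nat) (J U : 'M[F]_p)
    (b : 'M[F]_(p, r)) (c : 'M[F]_(p, s)) :
  no_identity_block U -> U^T *m J *m U = J -> U *m b = b -> U *m c = c ->
  b^T *m J *m c = 0.
Proof.
move=> /no_identity_block_split[L [iota [X [Y /= XY]]]] UJ Ub Uc.
have bJU : b^T *m J *m U = b^T *m J.
  by rewrite -{1}Ub trmx_mul -2!mulmxA (mulmxA U^T) UJ.
apply: (map_mx_inj (f := iota)); rewrite map_mxM map_mx0.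
(* With 1 = X M + M Y inserted before c, the first term dies by M c = 0 and the second by b^T J M =
   0. *)
rewrite -[map_mx iota c]mul1mx -XY mulmxDl -mulmxA mulmxBl mul1mx -map_mxM Uc.
rewrite subrr mulmx0 add0r !mulmxA mulmxBr mulmx1 -map_mxM bJU subrr.
by rewrite !mul0mx.
Qed.

(** * Reflection length and the rank of g - 1 *)

(** A vector space is not the union of two proper subspaces, here the kernels of y and z. *)
Lemma exists_common_nonzero (F : fieldType) (k : nat) (y z : 'rV[F]_k) :
  y != 0 -> z != 0 -> exists u : 'cV[F]_k, (y *m u) 0 0 != 0 /\ (z *m u) 0 0 != 0.
Proof.
have ex (y' : 'rV[F]_k) : y' != 0 -> exists u : 'cV[F]_k, (y' *m u) 0 0 != 0.
  by case/rV0Pn=> i ni; exists (delta_mx i 0); rewrite -colE mxE.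
move=> /ex[u yu] /ex[v zv].
have [zu|] := eqVneq ((z *m u) 0 0) 0; last by exists u.
have [yv|] := eqVneq ((y *m v) 0 0) 0; last by exists v.
exists (u + v); move: yu zv zu yv; rewrite !mulmxDr !mxE => yu zv -> ->.
by rewrite addr0 add0r.
Qed.

(* Wedderburn's rank reduction. *)
Lemma rank_reduce (F : fieldType) (k : nat) (M : 'M[F]_k) (v : 'rV[F]_k) (u : 'cV[F]_k) :
  (v *m M *m u) 0 0 != 0 ->
  (\rank (M - ((v *m M *m u) 0 0)^-1 *: (M *m u *m (v *m M)))%R < \rank M)%N.
Proof.
set t := (v *m M *m u) 0 0 => t0; set M' := M - _.
have sub : (M' <= M)%MS.
  by rewrite /M' addmx_sub // eqmx_opp scalemx_sub // mulmxA submxMl.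
have M'u : M' *m u = 0.
  rewrite /M' mulmxBl -scalemxAl -!mulmxA (mulmxA v) [v *m M *m u]mx11_scalar -/t.
  by rewrite mul_mx_scalar -scalemxAr scalerA mulVf // scale1r subrr.
(* M' kills u but M does not, so the inclusion of row spaces is strict. *)
have : (M' < M)%MS.
  rewrite ltmxE sub /=; apply/negP=> /submxP[D ME].
  by move: t0; rewrite /t ME -!mulmxA M'u !mulmx0 mxE eqxx.
exact: rank_ltmx.
Qed.

(** Induction on a bound for the rank of g - 1: a Wedderburn step yields g = T h with T a
    reflection, h invertible and h - 1 of smaller rank. *)
Lemma reflection_product_rank (F : fieldType) (k : nat) (g : 'M[F]_k) :
  g \in unitmx -> exists2 r, (r <= \rank (g - 1%:M)%R)%N & reflection_product g r.
Proof.
elim: {g}(\rank _) {-2}g (leqnn (\rank (g - 1%:M)%R)) => [|n IH] g le_n gu.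
  exists 0%N => //; exists [::]; first by [].
  rewrite big_nil; apply/eqP; rewrite -subr_eq0 -mxrank_eq0.
  by move: le_n; rewrite leqn0.
set M := g - 1%:M in le_n *.
have [M0|Mn0] := eqVneq M 0.
  exists 0%N => //; exists [::] => //; rewrite big_nil.
  by apply/eqP; rewrite -subr_eq0; apply/eqP.
have [i ri] : exists i, row i M != 0.
  apply/existsP; apply: contraNT Mn0; rewrite negb_exists => /forallP h.
  by apply/eqP/row_matrixP=> i; rewrite row0; apply/eqP; have := h i; rewrite negbK.
set y := row i M in ri.
have yg : y *m invmx g != 0.
  by apply: contraNneq ri => h; rewrite -(mulmxKV gu y) h mul0mx.
(* y u <> 0 gives the rank drop, and y g^-1 u <> 0 keeps the new factor h
   invertible. *)
have [u [yu ygu]] := exists_common_nonzero ri yg.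
pose v : 'rV[F]_k := delta_mx 0 i.
have vM : v *m M = y by rewrite -rowE.
set t := (y *m u) 0 0 in yu.
have := @rank_reduce _ _ M v u; rewrite vM -/t => /(_ yu).
set E := t^-1 *: _; set h := g - E.
have -> : M - E = h - 1%:M by rewrite /M /h addrAC.
move=> lt_h.
pose x := t^-1 *: (M *m u); pose z := y *m invmx g; pose a := (z *m u) 0 0.
have gE : h = (1%:M - x *m z) *m g.
  by rewrite mulmxBl mul1mx -mulmxA mulmxKV // -scalemxAl.
have zx : z *m x = (1 - t^-1 * a)%:M.
  rewrite /x -scalemxAr /M mulmxBl mul1mx mulmxBr mulmxA mulmxKV //.
  rewrite [y *m u]mx11_scalar [z *m u]mx11_scalar -/t -/a.
  by rewrite -raddfB scale_scalar_mx mulrBr mulVf.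
have tV0 : t^-1 * a != 0 by rewrite mulf_neq0 ?invr_eq0.
(* Sherman-Morrison: the inverse of 1 - x z is 1 + x z / (1 - z x), and 1 - z x = a / t. *)
pose c := (t^-1 * a)^-1; pose T := 1%:M + c *: (x *m z).
have xzxz : x *m z *m (x *m z) = (1 - t^-1 * a) *: (x *m z).
  by rewrite -mulmxA (mulmxA z) zx mul_scalar_mx -scalemxAr.
have T_inv : (1%:M - x *m z) *m T = 1%:M.
  rewrite mulmxDr mulmx1 -scalemxAr mulmxBl mul1mx xzxz scalerBr scalerA -scalerBl.
  by rewrite mulrBr mulr1 opprB addrCA subrr addr0 mulVf // scale1r subrK.
have [_ Tu] := mulmx1_unit T_inv.
have ghT : g = T *m h by rewrite gE mulmxA (mulmx1C T_inv) mul1mx.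
have hu : h \in unitmx by move: gu; rewrite ghT unitmx_mul => /andP[].
have Trefl : is_reflection T.
  split=> //; apply/eqP; rewrite eqn_leq; apply/andP; split.
    rewrite /T addrC addKr scalemxAl.
    by rewrite (leq_trans (mxrankM_maxl _ _)) ?rank_leq_col.
  (* T = 1 would give h = g, against the drop in rank. *)
  rewrite lt0n mxrank_eq0 subr_eq0; apply: contraTneq lt_h => T1.
  by rewrite /M ghT T1 mul1mx ltnn.
have [|r le_r [s [sz_s s_refl] h_prod]] := IH h _ hu.
  by rewrite -ltnS (leq_trans lt_h).
exists r.+1; first exact: leq_ltn_trans le_r lt_h.
exists (T :: s); first split; first by rewrite /= sz_s.
  by move=> T'; rewrite inE => /orP[/eqP->//|]; apply: s_refl.
by rewrite big_cons -h_prod.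
Qed.

Lemma rank_mulmx_sub1 (F : fieldType) (k : nat) (A B : 'M[F]_k) :
  (\rank (A *m B - 1%:M)%R <= \rank (A - 1%:M)%R + \rank (B - 1%:M)%R)%N.
Proof.
have -> : A *m B - 1%:M = (A - 1%:M) *m B + (B - 1%:M).
  by rewrite mulmxBl mul1mx addrA subrK.
by apply: leq_trans (mxrank_add _ _) _; rewrite leq_add2r mxrankM_maxl.
Qed.

Lemma rank_reflection_product (F : fieldType) (k r : nat) (U : 'M[F]_k) :
  reflection_product U r -> (\rank (U - 1%:M)%R <= r)%N.
Proof.
case=> s [<- s_refl] ->; elim: s s_refl => [|T s IH] s_refl.
  by rewrite big_nil subrr mxrank0.
rewrite big_cons; apply: leq_trans (rank_mulmx_sub1 _ _) _.
have [|_ ->] := s_refl T; first by rewrite mem_head.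
by rewrite add1n ltnS IH // => T' T's; apply: s_refl; rewrite inE T's orbT.
Qed.

Lemma rl_rank (F : fieldType) (k r : nat) (U : 'M[F]_k) :
  U \in unitmx -> rl U r -> r = \rank (U - 1%:M)%R.
Proof.
move=> Uu [Ur min_r]; apply/eqP; rewrite eqn_leq rank_reflection_product // andbT.
by have [r' le_r' /min_r/leq_trans->] := reflection_product_rank Uu.
Qed.

(** The row space of AB - 1 = (A - 1)B + (B - 1) lies in the sum S of those of (A - 1)B and B - 1.
    The rank bound forces equality, so B - 1 kills whatever AB - 1 kills. *)
Lemma fixed_of_rank_add (F : fieldType) (p r : nat) (A B : 'M[F]_p) (b : 'M[F]_(p, r)) :
  (\rank (A - 1%:M)%R + \rank (B - 1%:M)%R <= \rank (A *m B - 1%:M)%R)%N ->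
  A *m B *m b = b -> A *m b = b /\ B *m b = b.
Proof.
set W := A *m B - 1%:M => rankW ABb.
have WE : W = (A - 1%:M) *m B + (B - 1%:M) by rewrite mulmxBl mul1mx addrA subrK.
set S := ((A - 1%:M)%R *m B + (B - 1%:M)%R)%MS.
have WS : (W <= S)%MS.
  by rewrite WE addmx_sub_adds.
have SW : (S <= W)%MS.
  rewrite -(geq_leqif (mxrank_leqif_sup WS)); apply: leq_trans rankW.
  by apply: leq_trans (mxrank_adds_leqif _ _) _; rewrite leq_add2r mxrankM_maxl.
have /submxP[D BE] : (B - 1%:M <= W)%MS by apply: submx_trans SW; apply: addsmxSr.
have Bb : B *m b = b.
  apply/eqP; rewrite -subr_eq0 -{2}[b]mul1mx -mulmxBl BE -mulmxA.
  by rewrite mulmxBl ABb mul1mx subrr mulmx0.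
by split=> //; rewrite -{1}Bb mulmxA.
Qed.

(** * Shears and centralizers in an orthogonal sum *)

(** Two matrices are allowed so that one count serves both formulas; [B1 = B2] gives a single
    centralizer. *)
Definition centI (F : finFieldType) (N : nat) (G B1 B2 : 'M[F]_N) : {set 'M[F]_N} :=
  [set A in isom G | (A *m B1 == B1 *m A) && (A *m B2 == B2 *m A)].

(** For b^T J b = 0 this is the exponential 1 + N + N^2/2 of N = [[0, b], [J' b^T J, 0]], where N^3
    = 0. *)
Definition shear (F : fieldType) (p r : nat) (J : 'M[F]_p) (J' : 'M[F]_r)
    (b : 'M[F]_(p, r)) : 'M[F]_(p + r) :=
  block_mx (1%:M + 2%:R^-1 *: (b *m J' *m b^T *m J)) b (J' *m b^T *m J) 1%:M.

Lemma isomMl (F : finFieldType) (N : nat) (G A B : 'M[F]_N) :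
  A \in isom G -> (A *m B \in isom G) = (B \in isom G).
Proof.
rewrite !inE trmx_mul => /eqP AG.
by rewrite -!mulmxA (mulmxA A^T) (mulmxA (A^T *m G)) AG.
Qed.

(* The constant 2^-1 in shear makes the cross terms of the upper left block cancel
   J b J' b^T J exactly; the quadratic term vanishes as b^T J b = 0. *)
Lemma shear_isom (F : finFieldType) (p r : nat) (J : 'M[F]_p) (J' : 'M[F]_r)
    (b : 'M[F]_(p, r)) :
  2%:R != 0 :> F -> J^T = - J -> J'^T = - J' -> J' *m J' = - 1%:M ->
  b^T *m J *m b = 0 ->
  shear J J' b \in isom (block_mx J 0 0 J').
Proof.
move=> two Jt J't J'J' bJb; rewrite inE /shear; apply/eqP.
have E : (1%:M + 2%:R^-1 *: (b *m J' *m b^T *m J))^T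
         = 1%:M + 2%:R^-1 *: (J *m b *m J' *m b^T).
  rewrite linearD linearZ /= trmx1 !trmx_mul trmxK Jt J't.
  by rewrite !(mulmxN, mulNmx) opprK !mulmxA.
have E' : (J' *m b^T *m J)^T = J *m b *m J'.
  by rewrite !trmx_mul trmxK Jt J't !(mulmxN, mulNmx) opprK !mulmxA.
rewrite tr_block_mx !mulmx_block !(mul0mx, mulmx0, addr0, add0r) E E' trmx1.
have xx : (J *m b *m J' *m b^T) *m J *m (b *m J' *m b^T *m J) = 0.
  by rewrite -!mulmxA (mulmxA b^T) (mulmxA (b^T *m J)) bJb mul0mx !mulmx0.
congr block_mx.
- rewrite !(mulmxDl, mulmxDr) -!scalemxAl -!scalemxAr !(mul1mx, mulmx1) xx !scaler0 addr0.
  rewrite !mulmxA -(mulmxA (J *m b) J' J') J'J' mulmxN mulmx1 !mulNmx.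
  rewrite -(addrA J) -scalerDl -mulr2n -[_ *+ 2]mulr_natr mulVf //.
  by rewrite scale1r addrK.
- rewrite mulmx1 !mulmxDl mul1mx -!scalemxAl.
  rewrite -(mulmxA _ J) -(mulmxA _ b^T) (mulmxA b^T) bJb mulmx0 scaler0 addr0.
  by rewrite -(mulmxA (J *m b)) J'J' mulmxN mulmx1 subrr.
- rewrite mul1mx !mulmxDr mulmx1 -!scalemxAr !mulmxA.
  by rewrite bJb !mul0mx scaler0 addr0 J'J' mulNmx mul1mx mulNmx subrr.
- by rewrite bJb add0r mulmx1 mul1mx.
Qed.

Lemma shear_comm (F : fieldType) (p r : nat) (J U : 'M[F]_p) (J' : 'M[F]_r)
    (b : 'M[F]_(p, r)) :
  U^T *m J *m U = J -> U *m b = b ->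
  shear J J' b *m block_mx U 0 0 1%:M = block_mx U 0 0 1%:M *m shear J J' b.
Proof.
move=> UJ Ub; have bJU : b^T *m J *m U = b^T *m J.
  by rewrite -{1}Ub trmx_mul -2!mulmxA (mulmxA U^T) UJ.
rewrite /shear !mulmx_block !(mul0mx, mulmx0, addr0, add0r, mulmx1, mul1mx) Ub.
rewrite mulmxDl mulmxDr mul1mx mulmx1 -scalemxAl -scalemxAr !mulmxA Ub.
by rewrite -!(mulmxA _ _ U) -!(mulmxA _ _ (J *m U)) (mulmxA b^T) bJU !mulmxA.
Qed.

Lemma card_centI_block (F : finFieldType) (p r : nat) (J U1 U2 : 'M[F]_p)
    (J' : 'M[F]_r) :
  2%:R != 0 :> F -> J^T = - J -> J *m J = - 1%:M -> J'^T = - J' -> J' *m J' = - 1%:M ->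
  U1^T *m J *m U1 = J -> U2^T *m J *m U2 = J ->
  (forall b : 'M[F]_(p, r), U1 *m b = b -> U2 *m b = b -> b^T *m J *m b = 0) ->
  #|centI (block_mx J 0 0 J') (block_mx U1 0 0 1%:M) (block_mx U2 0 0 1%:M)|
    = (#|centI J U1 U2| * #|isom J'|
       * #|[set b : 'M[F]_(p, r) | (U1 *m b == b) && (U2 *m b == b)]|)%N.
Proof.
move=> two Jt JJ J't J'J' U1J U2J iso.
set X := centI J U1 U2; set Y := isom J'; set Z := [set b | _].
have J'u := unit_of_sqrN1 J'J'.
have Gu : block_mx J 0 0 J' \in unitmx.
  by rewrite unitmxE det_ublock unitrM -!unitmxE (unit_of_sqrN1 JJ).
have ZP b : b \in Z -> [/\ U1 *m b = b, U2 *m b = b & b^T *m J *m b = 0].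
  by rewrite inE => /andP[/eqP h1 /eqP h2]; split=> //; apply: iso.
pose f (t : 'M[F]_p * 'M[F]_r * 'M[F]_(p, r)) :=
  shear J J' t.2 *m block_mx t.1.1 0 0 t.1.2.
have fE a e b : f (a, e, b) =
    block_mx (a + 2%:R^-1 *: (b *m J' *m b^T *m J *m a)) (b *m e)
             (J' *m b^T *m J *m a) e.
  rewrite /f /shear mulmx_block !(mul0mx, mulmx0, addr0, add0r, mul1mx).
  by rewrite mulmxDl mul1mx -scalemxAl.
rewrite -!cardsX; set S := setX _ _.
rewrite -(card_in_imset (f := f) (D := S)).
  apply: eq_card => A; apply/idP/imsetP=> [|[[[a e] b] /setXP[/setXP[/= aX eY] bZ] ->]].
    rewrite -{1}[A]submxK; set a := ulsubmx A; set b := ursubmx A.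
    set c := dlsubmx A; set e := drsubmx A.
    rewrite inE => /and3P[].
    rewrite !mulmx_block !(mul0mx, mulmx0, addr0, add0r, mulmx1, mul1mx).
    move=> A_isom /eqP/eq_block_mx[aU1 bU1 _ _] /eqP/eq_block_mx[aU2 bU2 _ _].
    have Ab := iso b (esym bU1) (esym bU2).
    have A_isom' := A_isom; move: A_isom'.
    rewrite inE tr_block_mx !mulmx_block !(mul0mx, mulmx0, addr0, add0r).
    (* The lower right block of A^T G A = G reads b^T J b + e^T J' e = J', and b^T J b = 0 by
       isotropy. *)
    move=> /eqP/eq_block_mx[_ _ ce eE]; rewrite Ab add0r in eE.
    have eY : e \in Y by rewrite inE eE.
    have eu := isom_unit J'u eY.
    have [b0 b0D] : exists b0, b0 = b *m invmx e by exists (b *m invmx e).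
    have b0Z : b0 \in Z by rewrite inE b0D !mulmxA -bU1 -bU2 !eqxx.
    have b0e : b0 *m e = b by rewrite b0D mulmxKV.
    have [U1b0 U2b0 b0J] := ZP _ b0Z.
    (* As x^2 = 0, 1 - x is the inverse of the upper left block 1 + x of the shear. *)
    pose x := 2%:R^-1 *: (b0 *m J' *m b0^T *m J).
    have zz : b0^T *m J *m (b0 *m J' *m b0^T *m J) = 0.
      by rewrite !mulmxA b0J !mul0mx.
    pose a' := a - x *m a.
    have b0a' : b0^T *m J *m a' = b0^T *m J *m a.
      by rewrite mulmxBr mulmxA -scalemxAr zz scaler0 mul0mx subr0.
    (* The lower left block of the isometry equation determines c, because e and J' are
       invertible. *)
    have cE : c = J' *m b0^T *m J *m a.
      have : e^T *m (b0^T *m J *m a + J' *m c) = 0.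
        by rewrite mulmxDr !mulmxA -trmx_mul b0e ce.
      move/(congr1 (mulmx (invmx e^T))); rewrite mulKmx ?unitmx_tr // mulmx0.
      move=> /eqP; rewrite addr_eq0 => /eqP h.
      by rewrite -!mulmxA (mulmxA b0^T) h mulmxN mulmxA J'J' mulNmx mul1mx opprK.
    have ca' : J' *m b0^T *m J *m a' = c.
      by rewrite cE -!(mulmxA J') b0a'.
    have xa' : b0 *m J' *m b0^T *m J *m a' = b0 *m J' *m b0^T *m J *m a.
      by rewrite -!(mulmxA b0) ca' cE.
    have AE : block_mx a b c e = f (a', e, b0).
      by rewrite fE b0e ca' xa' /a' /x -scalemxAl subrK.
    exists (a', e, b0); last by rewrite -AE submxK.
    apply/setXP; split=> //; apply/setXP; split=> //=.
    move: A_isom; rewrite AE /f (isomMl _ (shear_isom two Jt J't J'J' b0J)) /=.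
    rewrite inE tr_block_mx !mulmx_block !(trmx0, mul0mx, mulmx0, addr0, add0r).
    move=> /eqP/eq_block_mx[a'J _ _ _]; rewrite !inE a'J eqxx /=.
    have comm_a' (V : 'M[F]_p) : V^T *m J *m V = J -> V *m b0 = b0 -> a *m V = V *m a ->
        a' *m V == V *m a'.
      (* The upper left block of [shear_comm] says that x commutes with V. *)
      move=> VJ Vb aV; have := shear_comm J' VJ Vb; rewrite /shear !mulmx_block -/x.
      rewrite !(mul0mx, mulmx0, addr0, add0r, mulmx1, mul1mx).
      move=> /eq_block_mx[xV _ _ _]; move: xV.
      rewrite mulmxDl mulmxDr mul1mx mulmx1 => /addrI xV.
      by rewrite /a' mulmxBl mulmxBr mulmxA -xV -!mulmxA aV.
    by rewrite !comm_a'.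
  have [U1b U2b bJ] := ZP _ bZ.
  rewrite !inE in aX eY; case/and3P: aX => /eqP aJ /eqP aU1 /eqP aU2.
  have comm (V : 'M[F]_p) : V^T *m J *m V = J -> V *m b = b -> a *m V = V *m a ->
      f (a, e, b) *m block_mx V 0 0 1%:M == block_mx V 0 0 1%:M *m f (a, e, b).
    move=> VJ Vb aV; rewrite /f /= mulmxA -(shear_comm J' VJ Vb) -!mulmxA.
    by rewrite !mulmx_block !(mul0mx, mulmx0, addr0, add0r, mulmx1, mul1mx) aV.
  rewrite inE !comm // andbT /f (isomMl _ (shear_isom two Jt J't J'J' bJ)) /=.
  rewrite inE tr_block_mx !mulmx_block !(trmx0, mul0mx, mulmx0, addr0, add0r).
  by rewrite aJ (eqP eY) eqxx.
move=> [[a e] b] [[a' e'] b'] /setXP[/setXP[/= _ eY] bZ] _.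
have [_ _ bJ] := ZP _ bZ.
(* Injectivity: e is the lower right block, the upper right block b e then gives b, and cancelling
   the invertible shear gives a. *)
rewrite !fE => fE_eq; have /eq_block_mx[_ h2 _ h4] := fE_eq.
have eu := isom_unit J'u eY.
have ebb : b = b' by rewrite -(mulmxK eu b) h2 h4 mulmxK // -h4.
move: fE_eq; rewrite -!fE /f /= -ebb => h.
have shu := isom_unit Gu (shear_isom two Jt J't J'J' bJ).
have := can_inj (mulKmx shu) h.
by move/eq_block_mx=> [-> _ _ ->]; rewrite ebb.
Qed.

(** * Transfer to the symplectic groups *)

Lemma centSpI (F : finFieldType) (n : nat) (B1 B2 : 'M[F]_(2 * n)) :
  centSp B1 :&: centSp B2 = centI (gram F n) B1 B2.
Proof.
rewrite /centSp /centI -Sp_isom; move: (Sp F n) => S.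
by apply/setP=> A; rewrite !inE; case: (A \in S).
Qed.

(** Each pair e_i, f_i occupies consecutive indices starting at an even one, so cutting at 2m
    separates no pair. *)
Lemma gram_decomp (F : finFieldType) (m n : nat) (le_mn : (m <= n)%N)
    (e : (2 * (n - m) = 2 * n - 2 * m)%N) :
  gram F n = castmx (upup_size le_mn, upup_size le_mn)
    (block_mx (gram F m) 0 0 (castmx (e, e) (gram F (n - m)))).
Proof.
apply/matrixP=> i j; rewrite castmxE mxE.
have o2 k : odd (2 * m + k) = odd k by rewrite oddD oddM.
have ev k l : (k < 2 * m)%N -> ~~ odd k -> (2 * m + l == k.+1)%N = false.
  move=> lt_k ek; apply/eqP=> kl; move: lt_k; rewrite leq_eqVlt -kl.
  rewrite [(_ < _)%N]ltnNge leq_addr orbF => /eqP lm.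
  by have := congr1 odd kl; rewrite lm /= oddM ek.
have lt k l : (k < 2 * m)%N -> (k == (2 * m + l).+1)%N = false.
  by move=> lt_k; apply/eqP=> kl; move: lt_k; rewrite kl ltnNge leqW ?leq_addr.
case: (split_ordP (cast_ord (esym (upup_size le_mn)) i)) => i' i'E;
  case: (split_ordP (cast_ord (esym (upup_size le_mn)) j)) => j' j'E;
  have /= vi := congr1 val i'E; have /= vj := congr1 val j'E;
  rewrite i'E j'E vi vj;
  rewrite ?block_mxEul ?block_mxEur ?block_mxEdl ?block_mxEdr ?castmxE !mxE /= ?o2 //.
- have [ei|oi] := boolP (odd i'); rewrite /= ?ev ?lt ?andbF //.
- have [ej|oj] := boolP (odd j'); rewrite /= ?ev ?lt ?andbF //.
- by rewrite -!addnS !eqn_add2l.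
Qed.

Lemma card_centI_cast (F : finFieldType) (M N : nat) (e : M = N) (G B1 B2 : 'M[F]_M) :
  #|centI (castmx (e, e) G) (castmx (e, e) B1) (castmx (e, e) B2)| = #|centI G B1 B2|.
Proof. by case: N / e; rewrite !castmx_id. Qed.

Lemma card_isom_cast (F : finFieldType) (M N : nat) (e : M = N) (G : 'M[F]_M) :
  #|isom (castmx (e, e) G)| = #|isom G|.
Proof. by case: N / e; rewrite castmx_id. Qed.

Lemma cast_tr_sqr (F : fieldType) (M N : nat) (e : M = N) (G : 'M[F]_M) :
  G^T = - G -> G *m G = - 1%:M ->
  (castmx (e, e) G)^T = - castmx (e, e) G /\
  castmx (e, e) G *m castmx (e, e) G = - 1%:M.
Proof. by case: N / e; rewrite castmx_id. Qed.

(** Common form of both counts: [U1] and [U2] are either both [U], or factors of [U] whose common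
    fixed space is that of [U]. *)
Lemma card_centSpI_upup (F : finFieldType) (m n : nat) (le_mn : (m <= n)%N)
    (U1 U2 U : 'M[F]_(2 * m)) :
  odd #|F| -> U1 \in Sp F m -> U2 \in Sp F m -> U \in Sp F m ->
  no_identity_block U ->
  (forall r (b : 'M[F]_(2 * m, r)), U *m b = b <-> U1 *m b = b /\ U2 *m b = b) ->
  #|centSp (upup le_mn U1) :&: centSp (upup le_mn U2)|
    = (#|centSp U1 :&: centSp U2| * #|Sp F (n - m)|
       * #|F| ^ (2 * (n - m) * dim_fix U))%N.
Proof.
rewrite !Sp_isom => oddF; rewrite !inE => /eqP U1J /eqP U2J /eqP UJ U_jordan fixU.
have e := mulnBr 2 n m.
have [J't J'J'] := cast_tr_sqr e (gram_tr F (n - m)) (gram_sqr F (n - m)).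
rewrite !centSpI (gram_decomp F le_mn e) /upup card_centI_cast.
rewrite card_centI_block ?two_neq0 ?gram_tr ?gram_sqr //; last first.
  move=> b U1b U2b; have Ub : U *m b = b by apply/fixU.
  exact: (fixed_isotropic U_jordan UJ Ub Ub).
rewrite card_isom_cast; congr (_ * _ * _)%N; rewrite e -card_fixed_mx.
apply: eq_card => b; rewrite !inE; apply/andP/eqP=> [[/eqP ? /eqP ?]|/fixU[-> ->]].
  exact/fixU.
by rewrite eqxx.
Qed.

Theorem theorem4p29 (F : finFieldType) (q : nat) (card_F : #|F| = q)
    (odd_q : odd q) (m n : nat) (le_mn : (m <= n)%N)
    (U1 U2 U : 'M[F]_(2 * m)) (U1_Sp : U1 \in Sp F m) (U2_Sp : U2 \in Sp F m)
    (U_def : U = U1 *m U2) (d : nat) (d_def : d = dim_fix U)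
    (U_jordan : no_identity_block U) :
  #|centSp (upup le_mn U)|
    = (#|centSp U| * #|Sp F (n - m)| * q ^ (2 * (n - m) * d))%N
  /\ (forall r1 r2 r : nat, rl U1 r1 -> rl U2 r2 -> rl U r ->
        (r1 + r2)%N = r ->
        #|centSp (upup le_mn U1) :&: centSp (upup le_mn U2)|
          = (#|centSp U1 :&: centSp U2| * #|Sp F (n - m)|
             * q ^ (2 * (n - m) * d))%N).
Proof.
have U_Sp : U \in Sp F m.
  by move: U1_Sp U2_Sp; rewrite U_def !Sp_isom => /isomMl->.
rewrite -card_F d_def; rewrite -card_F in odd_q; split=> [|r1 r2 r rl1 rl2 rlU r12].
  rewrite -[centSp (upup _ _)]setIid -[centSp U]setIid.
  by apply: card_centSpI_upup => // r b; split=> [|[]].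
apply: card_centSpI_upup => // s b.
split=> [|[U1b U2b]]; last by rewrite U_def -mulmxA U2b U1b.
have Sp_unit (A : 'M[F]_(2 * m)) : A \in Sp F m -> A \in unitmx.
  by rewrite inE => /andP[].
(* Additivity of the reflection lengths becomes additivity of ranks through [rl_rank]. *)
rewrite U_def; apply: fixed_of_rank_add.
by rewrite -U_def -(rl_rank _ rl1) -?(rl_rank _ rl2) -?(rl_rank _ rlU) ?r12 ?Sp_unit.
Qed.
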